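(* Let $K\subset\mathbb{R}^d$ be a convex body with volume $\ell_d(K)\in(0,\infty)$ and let $\gamma\in(0,\infty)$. Let $\mu$ be a probability measure given by one of the following two models. (In) $\mu$ is the restriction of the $d$-dimensional Lebesgue measure $\ell_d$ to $K$, normalized by $\ell_d(K)^{-1}$. (Bd) The boundary $\partial K$ of $K$ is a $C^2$-smooth submanifold with everywhere strictly positive Gaussian curvature, and $\mu$ is the restriction of the $(d-1)$-dimensional Hausdorff measure $\mathscr{H}^{d-1}$ to $\partial K$, normalized by $\mathscr{H}^{d-1}(\partial K)^{-1}$. Let $\eta$ be a Poisson process in $\mathbb{R}^d$ with intensity measure $\gamma\mu$, and let $F:=V_i(\mathrm{conv}(\eta))$ for some $i\in\{1,\dots,d-1\}$, where $V_i$ is the $i$-th intrinsic volume and $\mathrm{conv}(\eta)$ is the convex hull of the support of $\eta$. Then $$\mathbb{P}(F\ge\mathbb{E}[F]+t)\le\exp\Big\{-\frac{c\,t^2}{(i+1)V_i(K)^2}\Big\},\qquad \mathbb{P}(F\le\mathbb{E}[F]-t)\le\exp\Big\{-\frac{c\,t^2}{\gamma\,V_i(K)^2}\Big\}$$ for every $t\ge 4\sqrt{\kappa}$, where $c=\log(2)/(8\kappa)$ and $\kappa=\frac{\sqrt{e}}{2(\sqrt{e}-1)}$.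
   Context: A Poisson process $\eta$ in $\mathbb{R}^d$ with intensity measure $\gamma\mu$ is a random counting measure on $\mathbb{R}^d$, defined on a probability space $(\Omega,\mathcal{F},\mathbb{P})$, such that $\eta(B)$ is Poisson distributed with mean $\gamma\mu(B)$ for each Borel set $B\subset\mathbb{R}^d$, and $\eta(B_1),\dots,\eta(B_n)$ are independent for pairwise disjoint Borel sets $B_1,\dots,B_n$. For a compact convex set $K\subset\mathbb{R}^d$ and $i\in\{0,1,\dots,d\}$, the $i$-th intrinsic volume is $$V_i(K):=\binom{d}{i}\frac{\ell_d(B^d)}{\ell_i(B^i)\,\ell_{d-i}(B^{d-i})}\,\mathbb{E}[\ell_i(K|E)],$$ where $B^k$ is the $k$-dimensional unit ball, $\ell_k$ is $k$-dimensional Lebesgue measure, $E$ is a uniformly distributed $i$-dimensional random linear subspace of $\mathbb{R}^d$, and $K|E$ is the orthogonal projection of $K$ onto $E$. In particular $V_i(\varnothing)=0$. *)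

(* Defs.v *)
From HB Require Import structures.
From mathcomp Require Import all_boot all_order all_algebra.
From mathcomp Require Import all_classical all_reals all_analysis.
From mathcomp Require Import measurable_realfun.

Set Implicit Arguments.
Unset Strict Implicit.
Unset Printing Implicit Defensive.

Import Order.TTheory GRing.Theory Num.Theory.
Import numFieldNormedType.Exports.

Local Open Scope classical_set_scope.
Local Open Scope ring_scope.

(* Vectors of R^d are row vectors; [borel_mx R m n] is the matrix space
   'M[R]_(m, n) with its Borel sigma-algebra. *)
Definition borel_mx (R : realType) (m n : nat) :=
  g_sigma_algebraType (@open 'M[R]_(m, n)).

(* The norm the library puts on 'rV[R]_d is the sup norm. *)
Definition enorm (R : realType) (d : nat) (x : 'rV[R]_d) : R :=
  Num.sqrt (\sum_(j < d) x 0 j ^+ 2).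

Definition unit_ball (R : realType) (d : nat) : set 'rV[R]_d :=
  [set x | enorm x <= 1].

(* d-fold product of the Lebesgue measure of R: R^0 carries the Dirac mass at
   its only point and R^(d+1) = R x R^d. Only meaningful on Borel sets. *)
Fixpoint lebesgue_rV (R : realType) (d : nat) : set 'rV[R]_d -> \bar R :=
  match d with
  | 0 => fun A => (\1_A (0 : 'rV[R]_0))%:E
  | d'.+1 => fun A =>
      (\int[@lebesgue_measure R]_x
         lebesgue_rV [set y : 'rV[R]_d' | A (row_mx (x%:M : 'rV[R]_1) y)])%E
  end.

(* diam(A)^k, with diam(set0)^k = 0 for every k *)
Definition diam_pow (R : realType) (d k : nat) (A : set 'rV[R]_d) : \bar R :=
  maxe 0%E (ereal_sup [set (enorm (x - y) ^+ k)%:E | x in A & y in A]).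

Definition hausdorff_premeasure (R : realType) (d k : nat) (delta : R)
    (A : set 'rV[R]_d) : \bar R :=
  ereal_inf [set (\sum_(0 <= n <oo)
                   ((fine (lebesgue_rV (@unit_ball R k)) / 2 ^+ k)%:E
                    * diam_pow k (C n)))%E
            | C in [set C : nat -> set 'rV[R]_d
                   | A `<=` \bigcup_n C n /\
                     forall n x y, C n x -> C n y -> enorm (x - y) <= delta]].

Definition hausdorff_measure (R : realType) (d k : nat)
    (A : set 'rV[R]_d) : \bar R :=
  ereal_sup [set hausdorff_premeasure k delta A | delta in [set r | 0 < r]].

Definition convex_body (R : realType) (d : nat) (K : set 'rV[R]_d) : Prop :=
  [/\ K !=set0, compact K & convex_set K].

Definition convex_hull (R : realType) (d : nat) (A : set 'rV[R]_d) :
    set 'rV[R]_d :=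
  \bigcap_(C in [set C : set 'rV[R]_d | convex_set C /\ A `<=` C]) C.

Definition boundary (R : realType) (d : nat) (K : set 'rV[R]_d) :
    set 'rV[R]_d :=
  closure K `\` interior K.

Definition measure_support (R : realType) (d : nat)
    (m : set 'rV[R]_d -> \bar R) : set 'rV[R]_d :=
  [set x | forall U : set 'rV[R]_d, open U -> U x -> (0 < m U)%E].

Section hypersurface.
Context (R : realType) (d : nat).
Implicit Types (f : 'rV[R]_d -> R) (W K : set 'rV[R]_d) (x : 'rV[R]_d).

Definition partial (j : 'I_d) f x : R := 'D_(delta_mx 0 j) f x.

Definition C2_on W f : Prop :=
  forall x, W x ->
    {for x, continuous f} /\
    forall j : 'I_d,
      [/\ derivable f x (delta_mx 0 j),
          {for x, continuous (partial j f)} &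
          forall k : 'I_d, derivable (partial j f) x (delta_mx 0 k) /\
                           {for x, continuous (partial k (partial j f))}].

Definition gradient f x : 'rV[R]_d := \row_j partial j f x.

Definition unit_normal f x : 'rV[R]_d :=
  (enorm (gradient f x))^-1 *: gradient f x.

(* The rows of B are an orthonormal basis of the hyperplane tangent at x to the
   level set of f. *)
Definition tangent_basis f x (B : 'M[R]_(d.-1, d)) : Prop :=
  B *m B^T = 1%:M /\ B *m (gradient f x)^T = 0.

(* Determinant of the differential of the Gauss map on the tangent hyperplane,
   written in the orthonormal basis B (on which its value does not depend). *)
Definition gauss_curvature f x (B : 'M[R]_(d.-1, d)) : R :=
  \det ((\matrix_(a < d.-1) 'D_(row a B) (unit_normal f) x) *m B^T).

(* f is a C^2 equation of the boundary of K on W; f <= 0 on K makes the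
   gradient of f point out of K, which fixes the sign of the curvature. *)
Definition boundary_equation K W f : Prop :=
  [/\ C2_on W f,
      forall y, W y -> gradient f y != 0,
      W `&` boundary K = W `&` [set y | f y = 0] &
      W `&` K `<=` [set y | f y <= 0]].

Definition C2_positively_curved_boundary K : Prop :=
  forall x, boundary K x ->
    exists (W : set 'rV[R]_d) (f : 'rV[R]_d -> R),
      [/\ open W, W x, boundary_equation K W f &
          forall B, tangent_basis f x B -> 0 < gauss_curvature f x B].

End hypersurface.

(* A random i-dimensional linear subspace is given by a random orthonormal
   basis, the rows of E w. It is uniformly distributed when the law of the
   subspace, i.e. of the orthogonal projection matrix (E w)^T (E w) onto it, is
   invariant under the orthogonal group. *)
Definition uniform_subspace (R : realType) (d i : nat) (dE : measure_display)
    (OE : measurableType dE) (PE : probability OE R)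
    (E : OE -> 'M[R]_(i, d)) : Prop :=
  [/\ measurable_fun setT (E : OE -> borel_mx R i d),
      forall w, E w *m (E w)^T = 1%:M &
      forall (Q : 'M[R]_d) (A : set (borel_mx R d d)),
        Q *m Q^T = 1%:M -> measurable A ->
        PE [set w | A (Q^T *m ((E w)^T *m E w) *m Q)] =
        PE [set w | A ((E w)^T *m E w)]].

(* Coordinates, in the orthonormal basis given by the rows of U, of the
   orthogonal projection of K onto the subspace they span. *)
Definition projection (R : realType) (d i : nat) (U : 'M[R]_(i, d))
    (K : set 'rV[R]_d) : set 'rV[R]_i :=
  [set x *m U^T | x in K].

(* PE and E only serve to express the expectation over a uniformly distributed
   i-dimensional subspace: the value is the same for all uniform_subspace E. *)
Definition intrinsic_volume (R : realType) (d i : nat) (dE : measure_display)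
    (OE : measurableType dE) (PE : probability OE R)
    (E : OE -> 'M[R]_(i, d)) (K : set 'rV[R]_d) : R :=
  'C(d, i)%:R
  * (fine (lebesgue_rV (@unit_ball R d))
     / (fine (lebesgue_rV (@unit_ball R i))
        * fine (lebesgue_rV (@unit_ball R (d - i)))))
  * fine (\int[PE]_w lebesgue_rV (projection (E w) K))%E.

Definition independent_variables (R : realType) (dO : measure_display)
    (O : measurableType dO) (P : probability O R) (n : nat)
    (X : 'I_n -> O -> \bar R) : Prop :=
  forall A : 'I_n -> set (\bar R), (forall j, measurable (A j)) ->
    P (\bigcap_j (X j @^-1` A j)) = (\prod_j P (X j @^-1` A j))%E.

(* eta is a random counting measure: a kernel from the probability space to R^d
   with values in {0, 1, 2, ...} u {+oo}. The intensity is assumed finite. The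
   second argument of poisson_prob is a dummy. *)
Definition poisson_process (R : realType) (d : nat) (dO : measure_display)
    (O : measurableType dO) (P : probability O R)
    (eta : R.-ker O ~> borel_mx R 1 d)
    (intensity : set 'rV[R]_d -> \bar R) : Prop :=
  [/\ forall w (B : set (borel_mx R 1 d)), measurable B ->
        eta w B = +oo%E \/ exists n : nat, eta w B = (n%:R)%:E,
      forall (B : set (borel_mx R 1 d)) (n : nat), measurable B ->
        P [set w | eta w B = (n%:R)%:E] =
        poisson_prob (fine (intensity B)) 0 [set n] &
      forall (n : nat) (B : 'I_n -> set (borel_mx R 1 d)),
        (forall j, measurable (B j)) -> trivIset setT B ->
        independent_variables P (fun j w => eta w (B j))].

Definition model_In (R : realType) (d : nat) (K : set 'rV[R]_d)
    (mu : set 'rV[R]_d -> \bar R) : Prop :=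
  forall B : set (borel_mx R 1 d), measurable B ->
    mu B = ((fine (lebesgue_rV K))^-1%:E * lebesgue_rV (B `&` K))%E.

Definition model_Bd (R : realType) (d : nat) (K : set 'rV[R]_d)
    (mu : set 'rV[R]_d -> \bar R) : Prop :=
  C2_positively_curved_boundary K /\
  forall B : set (borel_mx R 1 d), measurable B ->
    mu B = ((fine (hausdorff_measure d.-1 (boundary K)))^-1%:E
            * hausdorff_measure d.-1 (B `&` boundary K))%E.

Definition kappa (R : realType) : R :=
  Num.sqrt (expR 1) / (2 * (Num.sqrt (expR 1) - 1)).

(* Main.v *)
Require Import Defs.
From HB Require Import structures.
From mathcomp Require Import all_boot all_order all_algebra.
From mathcomp Require Import all_classical all_reals all_analysis.
From mathcomp Require Import measurable_realfun.
From mathcomp Require Import ring lra.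

(** The volume [F] of the random hull takes its values in [0, V(K)] almost
surely, because almost surely no point of the process lies outside the closed
convex set [K] and [V] is monotone; and [F] vanishes when the process has no
point at all, which happens with probability [exp (- gamma)]. So, up to a
null set, [F <= V(K) * \1_A] where [A] is the event that the process is
nonempty, and [P A <= min (1, gamma)]. This domination alone gives both tails.

Indeed the expectation of [F] is at most [V(K) * P A], and its variance at
most [V(K)^2 * P A]. Put [s = V(K)^2] for the upper tail and
[s = gamma * V(K)^2] for the lower one; then [s] bounds the variance, and
either [t^2 <= s] or the event is negligible, since [F] cannot exceed [V(K)]
and cannot lie below its expectation by more than the expectation itself.
With [u = t^2 / s <= 1], Cantelli's inequality bounds the probability by
[1 / (1 + u) <= 1 - u / 2 <= exp (- u / 2)]; and the constant [c], a fortiori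
[c / (i + 1)], is at most [1/2] ([cantelli_exp], [upper_tail], [lower_tail]).

The work lies in the measurability of [F]. The probability [P] need not be
complete, and the process is an arbitrary kernel on a null set, where it may
have infinitely many points; so [F] has to be measurable without exception.
By Tonelli it suffices that the volume of the shadow of the hull on the
subspace spanned by [E e] is jointly measurable in the outcome [w] of the
process and in [e] ([measurable_volume_projection_hull]). Since volumes are
iterated integrals, this follows once membership of [x] in the shadow is a
measurable condition on [(w, e, x)] ([measurable_lebesgue_rV]). That
condition asks for points of the support and for weights, hence for a witness
in an uncountable set; [projection_hullP] replaces it by countably many
conditions with rational witnesses, by compactness. *)

Set Implicit Arguments.
Unset Strict Implicit.
Unset Printing Implicit Defensive.

Import Order.TTheory GRing.Theory Num.Theory.
Import numFieldNormedType.Exports.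

Local Open Scope classical_set_scope.
Local Open Scope ring_scope.

(** * One-sided tails of dominated random variables *)

Section moments.
Context (R : realType) (d : measure_display) (O : measurableType d).
Context (P : probability O R) (X : O -> R).
Hypothesis mX : measurable_fun setT X.

Lemma Lfun2_second_moment :
  ('E_P[(X ^+ 2)%R] < +oo)%E -> (X : O -> R) \in Lfun P 2%:E.
Proof.
move=> X2; rewrite inE; apply/andP; split; first by rewrite inE.
rewrite inE /= /finite_norm unlock; apply: poweR_lty.
apply: le_lt_trans X2; rewrite unlock le_eqVlt; apply/orP; left; apply/eqP.
apply: eq_integral => w _ /=.
by rewrite powR_mulrn// real_normK ?num_real.
Qed.

(** Cantelli's inequality bounds the probability by [1 / (1 + u)] with
[u = t^2 / s]; for [u <= 1] this is at most [1 - u / 2], hence at most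
[expR (- (u / 2))]. *)
Lemma cantelli_exp (c s t : R) : (X : O -> R) \in Lfun P 2%:E ->
  ('V_P[X] <= s%:E)%E -> c <= 2^-1 -> 0 < t -> t ^+ 2 <= s ->
  (P [set w | 'E_P[X] + t%:E <= (X w)%:E] <= (expR (- (c * t ^+ 2 / s)))%:E)%E.
Proof.
move=> X2 Vs c12 t0 ts.
have s0 : 0 < s by apply: lt_le_trans ts; rewrite exprn_gt0.
have X1 := Lfun_subset12 (fin_num_measure P _ measurableT) X2.
have finE := expectation_fin_num X1.
have finV := variance_fin_num X2.
pose Y : {RV P >-> R} := mfun_Sub (mem_set mX : X \in mfun).
have := @cantelli _ _ _ P Y t X2 t0.
rewrite /= (_ : [set w | _] =
  [set w | 'E_P[X] + t%:E <= (X w)%:E]%E); last first.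
  by apply/seteqP; split=> w /=; rewrite leeBrDr// addeC.
move=> /le_trans; apply; rewrite lee_fin.
have V0 : 0 <= fine 'V_P[X] by apply/fine_ge0/variance_ge0.
have {}Vs : fine 'V_P[X] <= s by rewrite -lee_fin fineK.
set v := fine _ in V0 Vs *; rewrite -exprnP.
set u := t ^+ 2 / s.
have u0 : 0 < u by rewrite divr_gt0// exprn_gt0.
have u1 : u <= 1 by rewrite ler_pdivrMr// mul1r.
have tE : t ^+ 2 = u * s by rewrite /u divfK// gt_eqF.
apply: (@le_trans _ _ (1 - u / 2)).
  have vs : 0 < v + t ^+ 2 by apply: ltr_wpDl => //; rewrite exprn_gt0.
  rewrite ler_pdivrMr// tE.
  have : 0 <= (s - v) * u by rewrite mulr_ge0// ?subr_ge0// ltW.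
  have : 0 <= u * s * (1 - u).
    by apply: mulr_ge0; [exact: mulr_ge0 (ltW u0) (ltW s0)|rewrite subr_ge0].
  nra.
apply: le_trans (expR_ge1Dx _); rewrite -mulrA -/u.
have : c * u <= 2^-1 * u by rewrite ler_pM2r.
lra.
Qed.

End moments.

(** A nonnegative variable that is almost surely dominated by the multiple
[V * \1_A] of an indicator function. The probability of [A] enters the second
moment linearly, which is what makes the lower tail depend on the mean number
of points. *)
Section bounded_variable.
Context (R : realType) (d : measure_display) (O : measurableType d).
Context (P : probability O R) (X : O -> R) (A : set O) (V : R).
Hypotheses (mX : measurable_fun setT X) (mA : measurable A).
Hypotheses (X0 : forall w, 0 <= X w) (V0 : 0 <= V).
Hypothesis XV : {ae P, forall w, X w <= V * \1_A w}.

Let mVA : measurable_fun setT (fun w => V * \1_A w : R).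
Proof. by apply: measurable_funM => //; exact: measurable_indic. Qed.

Let VA0 (a : R) w : 0 <= a -> 0 <= a * \1_A w.
Proof. by move=> a0; rewrite mulr_ge0// indicE. Qed.

Let E_indic (a : R) : ('E_P[(fun w => a * \1_A w)%R] = a%:E * P A)%E.
Proof.
rewrite unlock; under eq_integral do rewrite EFinM.
rewrite integralZl//; last (apply: integrable_indic => //).
by rewrite integral_indic// setIT.
Qed.

Lemma expectation_le_indic : ('E_P[X] <= V%:E * P A)%E.
Proof. by rewrite -E_indic; apply: expectation_le => // w; exact: VA0. Qed.

Lemma second_moment_le_indic : ('E_P[(X ^+ 2)%R] <= (V ^+ 2)%:E * P A)%E.
Proof.
rewrite -E_indic; apply: expectation_le => //.
- by rewrite expr2; exact: measurable_funM.
- by apply: measurable_funM => //; exact: measurable_indic.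
- by move=> w; exact: sqr_ge0.
- by move=> w; apply: VA0; rewrite exprn_ge0.
move: XV; apply: filterS => w.
rewrite fctE indicE; case: (w \in A); rewrite ?mulr1 ?mulr0 => XVw.
  by rewrite lerXn2r ?nnegrE.
by rewrite (le_anti (introT andP (conj XVw (X0 w)))) expr0n.
Qed.

Lemma Lfun2_le_indic : (X : O -> R) \in Lfun P 2%:E.
Proof.
apply: Lfun2_second_moment => //; apply: le_lt_trans second_moment_le_indic _.
by rewrite lte_mul_pinfty ?lee_fin ?exprn_ge0// -ge0_fin_numE// fin_num_measure.
Qed.

Lemma variance_le_indic : ('V_P[X] <= (V ^+ 2)%:E * P A)%E.
Proof.
have X2 := Lfun2_le_indic.
apply: le_trans second_moment_le_indic.
rewrite varianceE// leeBlDr; last first.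
  rewrite fin_numX// expectation_fin_num//.
  exact: Lfun_subset12 (fin_num_measure P _ measurableT) _ X2.
by rewrite leeDl// sqre_ge0.
Qed.

(** For [V < t] the event is negligible, so that Cantelli's inequality is
only needed for [t <= V], with the variance bound [V ^+ 2]. *)
Lemma upper_tail (c t : R) : c <= 2^-1 -> 0 < t ->
  (P [set w | 'E_P[X] + t%:E <= (X w)%:E] <=
   (expR (- (c * t ^+ 2 / V ^+ 2)))%:E)%E.
Proof.
move=> c12 t0; have X2 := Lfun2_le_indic.
have finE : 'E_P[X]%E \is a fin_num.
  apply: expectation_fin_num.
  exact: Lfun_subset12 (fin_num_measure P _ measurableT) _ X2.
have [tV|Vt] := leP t V.
  apply: cantelli_exp => //; last by rewrite lerXn2r ?nnegrE// ltW.
  apply: le_trans variance_le_indic _; rewrite -[leRHS]mule1.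
  by rewrite lee_wpmul2l ?lee_fin ?exprn_ge0// probability_le1.
rewrite (_ : P _ = 0%E) ?lee_fin ?expR_ge0//.
case: XV => N [mN PN subN]; apply: (subset_measure0 _ mN _ PN).
  rewrite -[X in measurable X]setTI; apply: emeasurable_fun_c_infty => //.
  exact/measurable_EFinP.
move=> w /=; rewrite -(fineK finE) -EFinD lee_fin => EX.
apply: subN => /=; apply/negP; rewrite -ltNge.
have : 0 <= fine 'E_P[X] by apply/fine_ge0/expectation_ge0.
have : V * \1_A w <= V by rewrite ler_piMr// indicE lern1; case: (_ \in _).
lra.
Qed.

(** As [X] is nonnegative, the event is empty unless [t] is at most the
expectation, which is at most both [V] and [V * p]; hence
[t ^+ 2 <= p * V ^+ 2]. *)
Lemma lower_tail (c p t : R) : c <= 2^-1 -> 0 < t -> (P A <= p%:E)%E ->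
  (P [set w | (X w)%:E <= 'E_P[X] - t%:E] <=
   (expR (- (c * t ^+ 2 / (p * V ^+ 2))))%:E)%E.
Proof.
move=> c12 t0 PAp; have X2 := Lfun2_le_indic.
have X1 := Lfun_subset12 (fin_num_measure P _ measurableT) X2.
have finE := expectation_fin_num X1.
have PA0 : 0 <= fine (P A) by exact: fine_ge0.
have PAE : P A = (fine (P A))%:E by rewrite fineK// fin_num_measure.
have PA1 : fine (P A) <= 1 by rewrite -lee_fin -PAE probability_le1.
have {}PAp : fine (P A) <= p by rewrite -lee_fin -PAE.
have EX : fine 'E_P[X] <= V * fine (P A).
  by rewrite -lee_fin EFinM -PAE fineK// expectation_le_indic.
have [tE|Et] := leP t (fine 'E_P[X]); last first.
  rewrite (_ : [set w | _] = set0) ?measure0 ?lee_fin ?expR_ge0//.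
  rewrite -subset0 => w /=; rewrite -(fineK finE) -EFinB lee_fin.
  by have := X0 w; lra.
have EN : ('E_P[(\- X)%R] = - 'E_P[X])%E.
  rewrite -[RHS]mulN1e -expectationZl//; congr expectation.
  by apply/funext => w /=; rewrite mulrN1.
rewrite (_ : [set w | _] =
  [set w | 'E_P[(\- X)%R] + t%:E <= (- X w)%:E]%E); last first.
  by apply/seteqP; split=> w /=;
    rewrite EN -(fineK finE) -EFinN -EFinB -EFinD !lee_fin; lra.
apply: cantelli_exp => //.
- exact: measurableT_comp.
- by rewrite rpredN//= ?lee1n.
- rewrite varianceN//; apply: le_trans variance_le_indic _.
  by rewrite PAE -EFinM lee_fin mulrC ler_wpM2r ?exprn_ge0.
- have tV : t <= V * fine (P A) by exact: le_trans EX.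
  have tV1 : t <= V by apply: le_trans tV _; rewrite ler_piMr.
  have tVp : t <= V * p by apply: le_trans tV _; rewrite ler_wpM2l.
  rewrite (_ : p * V ^+ 2 = V * (V * p)); last by ring.
  by rewrite expr2 ler_pM// ltW.
Qed.

End bounded_variable.

(** * Convex hulls as sets of finite convex combinations *)

Definition weighted_sum (R : realType) (d N : nat) (z : 'I_N -> 'rV[R]_d * R) :
  'rV[R]_d := \sum_j (z j).2 *: (z j).1.

Section convex_hull_finite.
Context (R : realType) (d : nat).
Implicit Types (S C K : set 'rV[R]_d) (y : 'rV[R]_d).

Definition is_weighting S N (z : 'I_N -> 'rV[R]_d * R) :=
  [/\ forall j, S (z j).1, forall j, 0 <= (z j).2 & \sum_j (z j).2 = 1].

Lemma convex_setP C (a : R) x y : convex_set C -> C x -> C y ->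
  0 <= a -> a <= 1 -> C (a *: x + (1 - a) *: y).
Proof.
move=> cC Cx Cy a0 a1.
by have := cC x y (Itv01 a0 a1) (mem_set Cx) (mem_set Cy); rewrite inE.
Qed.

(** By induction on the number of points: the normalized sum of the last [N]
points lies in [C], and the first point is averaged with it. Leaving the
weights unnormalized keeps the induction hypothesis applicable to the
last [N] weights. *)
Lemma convex_weighted_sum C N (z : 'I_N -> 'rV[R]_d * R) : convex_set C ->
  (forall j, C (z j).1) -> (forall j, 0 <= (z j).2) ->
  0 < \sum_j (z j).2 ->
  C ((\sum_j (z j).2)^-1 *: weighted_sum z).
Proof.
move=> cC; elim: N z => [|N IHN] z Cz z0; first by rewrite big_ord0 ltxx.
rewrite /weighted_sum !big_ord_recl.
pose z' j := z (lift ord0 j).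
rewrite -/(weighted_sum z'); set s := \sum_(j < N) _ => s0.
have : 0 <= s by apply: sumr_ge0.
rewrite le_eqVlt => /orP[/eqP s00|sgt0].
  (* All the mass is on the first point. *)
  have z'0 j : (z' j).2 = 0.
    move/esym/eqP: s00; rewrite psumr_eq0// => /allP/(_ j).
    by rewrite mem_index_enum => /(_ isT)/eqP.
  rewrite [weighted_sum z']big1 => [|j _]; last by rewrite z'0 scale0r.
  move: s0; rewrite -s00 !addr0 => s0.
  by rewrite scalerA mulVf ?gt_eqF// scale1r.
have := IHN z' (fun j => Cz _) (fun j => z0 _) sgt0; rewrite -/s => Cz'.
set a := (z ord0).2 in s0 *.
have a0 : 0 <= a by exact: z0.
have := convex_setP cC (Cz ord0) Cz' (divr_ge0 a0 (ltW s0)).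
rewrite ler_pdivrMr// mul1r lerDl => /(_ (ltW sgt0)).
rewrite scalerA scalerDr scalerA mulrC.
rewrite (_ : (1 - _) * _ = (a + s)^-1)//.
by field; rewrite !gt_eqF.
Qed.

Lemma convex_hullP S y : convex_hull S y <->
  exists N (z : 'I_N -> 'rV[R]_d * R), is_weighting S z /\ weighted_sum z = y.
Proof.
split=> [Sy|[N [z [[Sz z0 z1] <-]]] C [cC SC]]; last first.
  rewrite -[weighted_sum z]scale1r -invr1 -z1.
  by apply: convex_weighted_sum => //; [move=> j; exact: SC|rewrite z1].
apply: (Sy [set y | exists N (z : 'I_N -> 'rV[R]_d * R),
  is_weighting S z /\ weighted_sum z = y]); split; last first.
  move=> x Sx; exists 1%N, (fun=> (x, 1)); split.
    by split=> //; rewrite big_ord1.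
  by rewrite /weighted_sum big_ord1 scale1r.
move=> x1 x2 a; rewrite !inE => -[N1 [z1 [[S1 p1 s1] <-]]].
move=> [N2 [z2 [[S2 p2 s2] <-]]].
pose b : R := 1 - a%:num; have b0 : 0 <= b by rewrite subr_ge0.
exists (N1 + N2)%N, (fun j : 'I_(N1 + N2) => match fintype.split j with
  | inl k => ((z1 k).1, a%:num * (z1 k).2)
  | inr k => ((z2 k).1, b * (z2 k).2) end).
have splitl k : fintype.split (lshift N2 k) = inl k :> 'I_N1 + 'I_N2.
  by rewrite -[lshift _ _]/(unsplit (inl k)) unsplitK.
have splitr k : fintype.split (rshift N1 k) = inr k :> 'I_N1 + 'I_N2.
  by rewrite -[rshift _ _]/(unsplit (inr k)) unsplitK.
split; first split.
- by move=> j; case: fintype.split => k /=.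
- by move=> j; case: fintype.split => k /=; rewrite mulr_ge0.
- rewrite big_split_ord /=.
  under eq_bigr do rewrite splitl; rewrite -mulr_sumr s1 mulr1.
  under eq_bigr do rewrite splitr; rewrite -mulr_sumr s2 mulr1.
  by rewrite addrC subrK.
rewrite /weighted_sum big_split_ord /=.
under eq_bigr do rewrite splitl -scalerA.
rewrite -scaler_sumr.
under [X in _ + X]eq_bigr do rewrite splitr -scalerA.
by rewrite -scaler_sumr.
Qed.

Lemma convex_hull_sub S K : convex_set K -> S `<=` K -> convex_hull S `<=` K.
Proof. by move=> cK SK y; apply. Qed.

Lemma convex_hull0 : convex_hull set0 = set0 :> set 'rV[R]_d.
Proof.
by rewrite -subset0; apply: convex_hull_sub => // x y a; rewrite !inE.
Qed.

End convex_hull_finite.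

(** * Shadows of hulls of supports with rational witnesses *)

(** A limit point [z] of the nested sets comes with a filter converging to it
and containing every [C m]; limits along that filter replace the
extraction of a subsequence. *)
Lemma compact_nested (T : topologicalType) (Z : set T) (C : nat -> set T) :
  compact Z -> (forall m, C m.+1 `<=` C m) -> (forall m, Z `&` C m !=set0) ->
  exists z, Z z /\ exists G : set_system T,
    [/\ ProperFilter G, G --> z & forall m, G (C m)].
Proof.
move=> cZ Cdec ZC.
have Cmono m n : (m <= n)%N -> C n `<=` C m.
  elim: n => [|n IHn]; first by rewrite leqn0 => /eqP->.
  rewrite leq_eqVlt => /predU1P[->//|]; rewrite ltnS => /IHn.
  by apply: subset_trans; exact: Cdec.
pose F := filter_from [set: nat] (fun m => Z `&` C m).
have FF : ProperFilter F.
  apply: filter_from_proper => [|m _]; last exact: ZC.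
  apply: filter_from_filter => [|m n _ _]; first by exists 0.
  exists (maxn m n) => // z [Zz Cz]; split; split=> //.
  - by apply: Cmono Cz; rewrite leq_maxl.
  - by apply: Cmono Cz; rewrite leq_maxr.
have [|z [Zz]] := cZ F FF; first by exists 0 => // z [].
rewrite cluster_cvgE => -[G PG [Gz FG]].
exists z; split=> //; exists G; split=> // m.
by apply: FG; exists m => // u [].
Qed.

Lemma cvg_weighted_sum (R : realType) (d N : nat) (T : Type)
    (F : set_system T) {FF : Filter F} (f : T -> 'I_N -> 'rV[R]_d * R)
    (z : 'I_N -> 'rV[R]_d * R) :
  (forall j, (fun t => (f t j).1) @ F --> (z j).1) ->
  (forall j, (fun t => (f t j).2) @ F --> (z j).2) ->
  (fun t => weighted_sum (f t)) @ F --> weighted_sum z.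
Proof.
move=> f1 f2; apply: cvg_big; first exact: add_continuous.
by move=> j _; apply: cvgZ.
Qed.

Lemma cvg_sum_weights (R : realType) (d N : nat) (T : Type)
    (F : set_system T) {FF : Filter F} (f : T -> 'I_N -> 'rV[R]_d * R)
    (z : 'I_N -> 'rV[R]_d * R) :
  (forall j, (fun t => (f t j).2) @ F --> (z j).2) ->
  (fun t => \sum_j (f t j).2) @ F --> \sum_j (z j).2.
Proof. by move=> f2; apply: cvg_big; first exact: add_continuous. Qed.

Lemma cvg_coord_mulmx (R : realType) (d i : nat) (T : Type)
    (F : set_system T) {FF : Filter F} (f : T -> 'rV[R]_d) (y : 'rV[R]_d)
    (U : 'M[R]_(i, d)) (x : 'rV[R]_i) k : f @ F --> y ->
  (fun t => (f t *m U^T - x) 0 k) @ F --> (y *m U^T - x) 0 k.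
Proof.
move=> fy.
have E (v : 'rV[R]_d) : (v *m U^T - x) 0 k = \sum_l v 0 l * U k l - x 0 k.
  by rewrite !mxE; congr (_ - _); apply: eq_bigr => l _; rewrite !mxE.
rewrite E; under eq_fun do rewrite E.
apply: cvgB; last exact: cvg_cst.
apply: cvg_big; first exact: add_continuous.
move=> l _; apply: cvgM; last exact: cvg_cst.
apply: (cvg_comp _ (fun v : 'rV[R]_d => v 0 l) fy).
exact: coord_continuous.
Qed.

Lemma eq0_le_invS (R : realType) (x : R) :
  (forall m, `|x| <= m.+1%:R^-1) -> x = 0.
Proof.
move=> xm; apply/eqP; rewrite -normr_le0; apply/ler_addgt0Pl => e e0.
rewrite addr0; have [m _ me] := near_infty_natSinv_lt (PosNum e0).
by apply: le_trans (xm m) _; apply/ltW/me => /=.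
Qed.

Lemma ler_invS (R : realType) (m n : nat) : (m <= n)%N ->
  n.+1%:R^-1 <= m.+1%:R^-1 :> R.
Proof. by move=> mn; rewrite lef_pV2 ?posrE// ler_nat ltnS. Qed.

Lemma closed_norm_le (R : realType) (V : normedModType R) (e : R) :
  closed [set y : V | `|y| <= e].
Proof.
rewrite (_ : [set _ | _] = closed_ball_ Num.norm 0 e).
  exact: closed_closed_ball_.
by apply/seteqP; split=> y /=; rewrite /closed_ball_ /= sub0r normrN.
Qed.

Section hull_approximation.
Context (R : realType) (d i : nat).
Context (nu : {measure set (borel_mx R 1 d) -> \bar R}).
Implicit Types (U : 'M[R]_(i, d)) (x : 'rV[R]_i).

Definition bounded_weighting (M N : nat) : set ('I_N -> 'rV[R]_d * R) :=
  [set z | forall j, `|(z j).1| <= M%:R /\ 0 <= (z j).2 <= M%:R].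

(** The conditions for a convex combination of points of the support to have
the shadow [x], each relaxed by an error [m.+1%:R^-1]. Membership of a point
in the support is relaxed to [nu] charging a ball around it, which is a
measurable condition on [nu]. *)
Definition near_weighting U x (m N : nat) : set ('I_N -> 'rV[R]_d * R) :=
  [set z | [/\ forall j, (0 < nu (ball (z j).1 m.+1%:R^-1))%E,
    `|\sum_j (z j).2 - 1| <= m.+1%:R^-1 &
    forall k, `|(weighted_sum z *m U^T - x) 0 k| <= m.+1%:R^-1]].

Definition real_weighting N (q : {ffun 'I_N -> 'rV[rat]_d * rat})
  (j : 'I_N) : 'rV[R]_d * R := (map_mx ratr (q j).1, ratr (q j).2).

Lemma measurable_ball_mx (y : 'rV[R]_d) e :
  measurable (ball y e : set (borel_mx R 1 d)).
Proof. by apply: sub_sigma_algebra; exact: ball_open. Qed.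

Lemma near_weighting_decr U x m N :
  near_weighting U x m.+1 (N := N) `<=` near_weighting U x m (N := N).
Proof.
have me : m.+2%:R^-1 <= m.+1%:R^-1 :> R by apply: ler_invS.
move=> z [z1 z2 z3]; split.
- move=> j; apply: lt_le_trans (z1 j) _; apply: le_measure.
  + by rewrite inE; exact: measurable_ball_mx.
  + by rewrite inE; exact: measurable_ball_mx.
  + exact: le_ball.
- exact: le_trans me.
- by move=> k; apply: le_trans me.
Qed.

Lemma compact_bounded_weighting M N :
  compact (bounded_weighting M (N := N) : set (prod_topology _)).
Proof.
apply: (@tychonoff _ (fun=> ('rV[R]_d * R)%type)
  (fun=> [set v | `|v.1| <= M%:R /\ 0 <= v.2 <= M%:R])) => _.
rewrite (_ : [set _ | _] = [set y | `|y| <= M%:R] `*` `[0, M%:R]); last first.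
  by apply/seteqP; split=> -[y a] /=; rewrite in_itv.
apply: compact_setX; last exact: segment_compact.
apply: bounded_closed_compact.
  exists M%:R; split; first by rewrite realE ler0n.
  by move=> a Ma y /= yM; apply: le_trans yM (ltW Ma).
exact: closed_norm_le.
Qed.

(** Errors that tend to zero disappear in the limit; the support needs this
argument because being charged by [nu] is tested on balls that shrink
around moving centres. *)
Lemma near_weighting_cvg U x N (T : Type) (G : set_system T)
    {PG : ProperFilter G} (f : T -> 'I_N -> 'rV[R]_d * R)
    (z : 'I_N -> 'rV[R]_d * R) :
  (forall j, (fun t => (f t j).1) @ G --> (z j).1) ->
  (forall j, (fun t => (f t j).2) @ G --> (z j).2) ->
  (forall m, \forall t \near G, near_weighting U x m (f t)) ->
  (forall j, 0 <= (z j).2) ->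
  projection U (convex_hull (measure_support nu)) x.
Proof.
move=> G1 G2 GC z0.
have FG : Filter G by exact: filter_filter.
have Gs := cvg_sum_weights (FF := FG) G2.
have Gw := cvg_weighted_sum (FF := FG) G1 G2.
exists (weighted_sum z); last first.
  apply/rowP => k; apply/subr0_eq.
  have -> : (weighted_sum z *m U^T) 0 k - x 0 k =
      (weighted_sum z *m U^T - x) 0 k by rewrite !mxE.
  apply: eq0_le_invS => m.
  have := cvg_coord_mulmx (FF := FG) (x := x) (k := k) (U := U) Gw.
  apply: (closed_cvg (fun r => `|r| <= _)); first exact: closed_norm_le.
  by apply: filterS (GC m) => t [].
apply/convex_hullP; exists N, z; split=> //; split=> //.
- move=> j W oW Wz.
  have /nbhs_ballP[r r0 rW] : nbhs (z j).1 W by exact: open_nbhs_nbhs.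
  have r20 : 0 < r / 2 by exact: divr_gt0.
  have [m _ mr] := near_infty_natSinv_lt (PosNum r20).
  have {}mr := mr m (leqnn _).
  have [t [/= zf [fj _ _]]] : exists t : T,
      ball (z j).1 (r / 2) (f t j).1 /\ near_weighting U x m (f t).
    apply: (@filter_ex _ G); apply: filterI (GC m).
    by apply: (G1 j); exact: nbhsx_ballx.
  apply: lt_le_trans (fj j) _; apply: le_measure.
  + by rewrite inE; exact: measurable_ball_mx.
  + by rewrite inE; exact: sub_sigma_algebra.
  + apply: subset_trans rW => u fu; rewrite (splitr r).
    by apply: ball_triangle zf _; apply: le_ball fu; exact: ltW.
apply/subr0_eq/eq0_le_invS => m.
have : (fun t => \sum_j (f t j).2 - 1) @ G --> \sum_j (z j).2 - 1.
  by apply: cvgB Gs _; exact: cvg_cst.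
apply: (closed_cvg (fun r => `|r| <= _)); first exact: closed_norm_le.
by apply: filterS (GC m) => t [].
Qed.

(** Compactness: boundedness of the points and of the weights provides the
limit. *)
Lemma near_weighting_limit U x M N :
  (forall m, bounded_weighting M (N := N) `&` near_weighting U x m (N := N)
     !=set0) ->
  projection U (convex_hull (measure_support nu)) x.
Proof.
move=> ne.
have [z [Zz [G [PG Gz GC]]]] := compact_nested
  (T := prod_topology (fun _ : 'I_N => ('rV[R]_d * R)%type))
  (@compact_bounded_weighting M N)
  (@near_weighting_decr U x ^~ N) ne.
have Gj j : (fun f : 'I_N -> 'rV[R]_d * R => f j) @ G --> z j.
  apply: (cvg_comp _
    (fun f : prod_topology (fun _ : 'I_N => ('rV[R]_d * R)%type) => f j) Gz).
  exact: (@proj_continuous 'I_N (fun=> ('rV[R]_d * R)%type) j z).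
apply: (@near_weighting_cvg U x N _ G PG id z) => //.
- by move=> j; apply: (cvg_comp _ fst (Gj j)); exact: cvg_fst.
- by move=> j; apply: (cvg_comp _ snd (Gj j)); exact: cvg_snd.
- by move=> j; have [_ /andP[]] := Zz j.
Qed.

Lemma ratr_above (r e : R) : 0 < e ->
  exists q : rat, r <= ratr q /\ ratr q < r + e.
Proof.
move=> e0; have /rat_in_itvoo[q] : r < r + e by rewrite ltrDl.
by rewrite in_itv /= => /andP[rq qr]; exists q; split=> //; exact: ltW.
Qed.

(** The approximation is from above on the weights, so that nonnegative
weights stay nonnegative. *)
Lemma real_weighting_dense N (z : 'I_N -> 'rV[R]_d * R) (e : R) : 0 < e ->
  exists q : {ffun 'I_N -> 'rV[rat]_d * rat}, forall j,
    ball (z j).1 e (real_weighting q j).1 /\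
    (z j).2 <= (real_weighting q j).2 < (z j).2 + e.
Proof.
move=> e0.
pose q (r : R) : rat := xget 0 [set q : rat | r <= ratr q /\ ratr q < r + e].
have qP r : r <= ratr (q r) /\ ratr (q r) < r + e.
  by rewrite /q; case: xgetP => [//|H]; case: (ratr_above r e0) => p /H.
exists [ffun j => (map_mx q (z j).1, q (z j).2)] => j.
rewrite /real_weighting ffunE /=; split; last by case: (qP (z j).2) => -> ->.
split=> // k l; rewrite !mxE /ball /= ltr_distl.
by have [] := qP ((z j).1 k l); lra.
Qed.

Lemma near_weighting_exists U x :
  projection U (convex_hull (measure_support nu)) x ->
  exists M N, forall m, exists q : {ffun 'I_N -> 'rV[rat]_d * rat},
    bounded_weighting M (real_weighting q) /\
    near_weighting U x m (real_weighting q).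
Proof.
move=> [_ /convex_hullP[N [z [[Sz z0 z1] <-]]] <-].
have /choice[q qz] (n : nat) : exists q : {ffun 'I_N -> 'rV[rat]_d * rat},
    forall j, ball (z j).1 n.+1%:R^-1 (real_weighting q j).1 /\
    (z j).2 <= (real_weighting q j).2 < (z j).2 + n.+1%:R^-1.
  exact: real_weighting_dense.
pose f n : 'I_N -> 'rV[R]_d * R := real_weighting (q n).
have f1 j : (fun n => (f n j).1) @ \oo --> (z j).1.
  apply/cvg_ballP => e e0.
  apply: filterS (near_infty_natSinv_lt (PosNum e0)) => n /ltW ne.
  by have [zn _] := qz n j; exact: le_ball zn.
have f2 j : (fun n => (f n j).2) @ \oo --> (z j).2.
  apply/cvgrPdist_lt => e e0.
  apply: filterS (near_infty_natSinv_lt (PosNum e0)) => n /= ne.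
  have [_ /andP[]] := qz n j; rewrite ltr_distl /= => q1 q2.
  rewrite ltrBlDr (lt_trans q2) ?ltrD2l//=.
  by apply: le_lt_trans q1 _; rewrite ltrDl.
have FF : Filter (\oo : set_system nat) by exact: filter_filter.
have Gs := cvg_sum_weights (FF := FF) f2.
have Gw := cvg_weighted_sum (FF := FF) f1 f2.
(* [B] bounds every point and every weight, with a margin for approximation. *)
pose B := \sum_j (`|(z j).1| + (z j).2 + 1).
have Bj j : `|(z j).1| + (z j).2 + 1 <= B.
  rewrite /B (bigD1 j) //= lerDl sumr_ge0// => k _.
  by rewrite !addr_ge0.
exists (Num.truncn B).+1, N => m.
have e0 : 0 < m.+1%:R^-1 :> R by [].
near \oo => n.
have nm : n.+1%:R^-1 <= m.+1%:R^-1 :> R.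
  by apply: ler_invS; near: n; exact: nbhs_infty_ge.
have n1 : n.+1%:R^-1 <= 1 :> R by rewrite invf_le1// ler1n.
have BM : B <= (Num.truncn B).+1%:R by apply/ltW/truncnS_gt.
exists (q n); split.
  move=> j; have [zn /andP[zn1 zn2]] := qz n j.
  have BjM := le_trans (Bj j) BM.
  split.
    have zn' : `|(real_weighting (q n) j).1| <= `|(z j).1| + n.+1%:R^-1.
      move: zn; rewrite -ball_normE /ball_ /= => /ltW zn.
      rewrite -[X in `|X|](subKr (z j).1) (le_trans (ler_normB _ _))//.
      by rewrite lerD2l.
    by apply: le_trans zn' (le_trans _ BjM); rewrite lerD// lerDl.
  rewrite (le_trans (z0 j) zn1)/= (le_trans (ltW zn2))//.
  by apply: le_trans BjM; rewrite lerD// lerDr.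
split.
- move=> j; apply: Sz; first exact: ball_open.
  by have [zn _] := qz n j; apply: ball_sym; exact: le_ball zn.
- near: n; have : (fun n => \sum_j (f n j).2 - 1) @ \oo --> (0 : R).
    have := cvgB Gs (cvg_cst (1 : R) (FF := FF)).
    by rewrite z1 subrr; exact.
  by move=> /cvgr0_norm_le; apply.
- near: n; apply: filter_forall => k; have := cvg_coord_mulmx
    (FF := FF) (x := weighted_sum z *m U^T) (k := k) (U := U) Gw.
  by rewrite subrr mxE => /cvgr0_norm_le; apply.
Unshelve. all: by end_near. Qed.

(** All quantifiers on the right range over countable types: this is what
makes the shadow measurable although a witness has real coordinates. The
bound [M] does not depend on [m], as compactness requires. *)
Lemma projection_hullP U x :
  projection U (convex_hull (measure_support nu)) x <->
  exists M N, forall m, exists q : {ffun 'I_N -> 'rV[rat]_d * rat},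
    bounded_weighting M (real_weighting q) /\
    near_weighting U x m (real_weighting q).
Proof.
split; first exact: near_weighting_exists.
move=> [M [N H]]; apply: (@near_weighting_limit U x M N) => m.
by have [q [qb qn]] := H m; exists (real_weighting q).
Qed.

End hull_approximation.

(** * Iterated Lebesgue integrals of sets *)

Section lebesgue_rV.
Context (R : realType).
Local Open Scope ereal_scope.

(** The integral of a nonnegative function is a supremum over the simple
functions below it, hence monotone even among nonmeasurable functions;
thus [lebesgue_rV] is monotone on all sets. *)
Lemma ge0_le_integralT (d : measure_display) (T : measurableType d)
    (mu : {measure set T -> \bar R}) (f g : T -> \bar R) :
  (forall t, 0 <= f t) -> (forall t, f t <= g t) ->
  \int[mu]_t f t <= \int[mu]_t g t.
Proof.
move=> f0 fg; have g0 t : 0 <= g t by exact: le_trans (fg t).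
rewrite !ge0_integralTE//; apply: le_ereal_sup => _ [h hf <-].
by exists h => // t; apply: le_trans (hf t) (fg t).
Qed.

Lemma lebesgue_rV_ge0 n (A : set 'rV[R]_n) : 0 <= lebesgue_rV A.
Proof.
elim: n A => [|n IHn] A; first by rewrite lee_fin indicE.
by apply: integral_ge0 => x _; exact: IHn.
Qed.

Lemma le_lebesgue_rV n (A B : set 'rV[R]_n) : A `<=` B ->
  lebesgue_rV A <= lebesgue_rV B.
Proof.
elim: n A B => [|n IHn] A B AB /=.
  rewrite lee_fin !indicE; have [A0|_] := boolP (0%R \in A); last exact: ler0n.
  by rewrite (mem_set (AB _ (set_mem A0))).
apply: ge0_le_integralT => x; first exact: lebesgue_rV_ge0.
by apply: IHn => y; exact: AB.
Qed.

Lemma lebesgue_rV0 n : lebesgue_rV (set0 : set 'rV[R]_n) = 0.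
Proof.
elim: n => [|n IHn] /=; first by rewrite indic0.
by rewrite integral0_eq.
Qed.

Lemma lebesgue_rV_box n (A : set 'rV[R]_n) (M : R) : (0 <= M)%R ->
  (forall x, A x -> forall j, `|x 0 j| <= M)%R ->
  lebesgue_rV A <= ((M + M) ^+ n)%:E.
Proof.
move=> M0; elim: n A => [|n IHn] A AM /=.
  by rewrite expr0 lee_fin indicE lern1 leq_b1.
have IH x : lebesgue_rV [set y : 'rV[R]_n | A (row_mx (x%:M : 'rV[R]_1) y)] <=
    (((M + M) ^+ n) * \1_(`[(- M)%R, M]%classic) x)%:E.
  rewrite indicE; have [xM|xM] := boolP (x \in _).
    rewrite mulr1; apply: IHn => y /AM yM j.
    by rewrite -(row_mxEr (x%:M : 'rV[R]_1)); exact: (yM (rshift 1 j)).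
  rewrite [X in lebesgue_rV X](_ : _ = set0) ?lebesgue_rV0 ?mulr0//.
  rewrite -subset0 => y /= /AM yM.
  have xE : row_mx (x%:M : 'rV[R]_1) y ord0 (lshift n ord0) = x.
    by rewrite row_mxEl mxE eqxx mulr1n.
  move: xM; rewrite notin_setE /= in_itv /= -ler_norml -{1}xE.
  by apply; exact: (yM (lshift n (ord0 : 'I_1))).
have /(ge0_le_integralT (@lebesgue_measure R)) := fun x : R =>
  lebesgue_rV_ge0 [set y : 'rV[R]_n | A (row_mx (x%:M : 'rV[R]_1) y)].
move=> /(_ _ IH) /le_trans; apply.
under eq_integral do rewrite EFinM.
rewrite ge0_integralZl//.
- rewrite integral_indic// setIT.
  have := lebesgue_measure_itv `[(- M)%R, M]; rewrite /= => E.
  rewrite [X in _ * X]E.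
  case: ifPn => _; last by rewrite mule0 lee_fin exprn_ge0// addr_ge0.
  by rewrite -EFinB -EFinM lee_fin opprK exprSr.
- by apply/measurable_EFinP/measurable_indic; exact: measurable_itv.
- by rewrite lee_fin exprn_ge0// addr_ge0.
Qed.

(** Testing membership in [A t] on arbitrary measurable parametrizations of [t]
and of the coordinates lets the induction on [n] move the first coordinate
into the parameter [t], without comparing the Borel sets of a product with the
product of the Borel sets. *)
Lemma measurable_lebesgue_rV (d : measure_display) (T : measurableType d) n
    (A : T -> set 'rV[R]_n) :
  (forall (d' : measure_display) (S : measurableType d') (g : S -> T)
     (f : 'I_n -> S -> R),
     measurable_fun setT g -> (forall j, measurable_fun setT (f j)) ->
     measurable [set s | A (g s) (\row_j f j s)]) ->
  measurable_fun setT (fun t => lebesgue_rV (A t)).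
Proof.
elim: n d T A => [|n IHn] d T A mA /=.
  apply/measurable_EFinP; rewrite (_ : (fun _ => _) = \1_[set t | A t 0%R]).
    apply: measurable_indic.
    have := mA _ T id (fun=> fun=> 0%R) (@measurable_id _ _ _)
      (fun=> measurable_cst _).
    by under eq_set do rewrite (thinmx0 (\row_j _)).
  by apply/funext => t; rewrite !indicE.
pose F (p : T * measurableTypeR R) :=
  lebesgue_rV [set y : 'rV[R]_n | A p.1 (row_mx (p.2%:M : 'rV[R]_1) y)].
apply: (@measurable_fun_fubini_tonelli_F _ _ _ (measurableTypeR R) R
  (@lebesgue_measure R) F); last first.
  by move=> p; exact: lebesgue_rV_ge0.
apply: IHn => d' S g f mg mf /=.
pose f' (j : 'I_(1 + n)) s :=
  match fintype.split j with inl _ => (g s).2 | inr k => f k s end.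
have mf' j : measurable_fun setT (f' j).
  rewrite /f'; case: (fintype.split j) => // _.
  exact: measurableT_comp measurable_snd mg.
have := mA _ S (fst \o g) f' (measurableT_comp measurable_fst mg) mf'.
congr (measurable _); apply: eq_set => s; congr (A _ _).
apply/rowP => j; rewrite !mxE /f'.
by case: fintype.split => k; rewrite !mxE// ord1 eqxx mulr1n.
Qed.

End lebesgue_rV.

(** * Joint measurability of the volume of the shadow *)

Section measurable_sets.
Context (d : measure_display) (S : measurableType d).

Lemma measurable_exists (U : countType) (Q : U -> S -> Prop) :
  (forall u, measurable [set s | Q u s]) ->
  measurable [set s | exists u, Q u s].
Proof.
move=> mQ; rewrite (_ : [set s | _] = \bigcup_u [set s | Q u s]).
  exact: countable_bigcupT_measurable.
by apply/seteqP; split=> s [u]; [exists u|move=> _; exists u].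
Qed.

Lemma measurable_forall (U : countType) (Q : U -> S -> Prop) :
  (forall u, measurable [set s | Q u s]) ->
  measurable [set s | forall u, Q u s].
Proof.
move=> mQ; rewrite (_ : [set s | _] = ~` [set s | exists u, ~ Q u s]).
  by apply/measurableC/measurable_exists => u; exact: (measurableC (mQ u)).
apply/seteqP; split=> s /= sQ; first by case=> u.
by move=> u; apply: contrapT => nQ; apply: sQ; exists u.
Qed.

Lemma measurable_and (Q1 Q2 : S -> Prop) :
  measurable [set s | Q1 s] -> measurable [set s | Q2 s] ->
  measurable [set s | Q1 s /\ Q2 s].
Proof. exact: measurableI. Qed.

Lemma measurable_and3 (Q1 Q2 Q3 : S -> Prop) :
  measurable [set s | Q1 s] -> measurable [set s | Q2 s] ->
  measurable [set s | Q3 s] -> measurable [set s | [/\ Q1 s, Q2 s & Q3 s]].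
Proof.
move=> m1 m2 m3; have := measurableI _ _ m1 (measurableI _ _ m2 m3).
by congr (measurable _); apply/seteqP; split=> s; [case=> ? []|case].
Qed.

Lemma measurable_constant (Q : Prop) : measurable [set s : S | Q].
Proof.
have [q|nq] := pselect Q.
  by rewrite (_ : [set _ | _] = setT)//; apply/seteqP; split.
by rewrite (_ : [set _ | _] = set0)//; apply/seteqP; split.
Qed.

End measurable_sets.

Lemma measurable_mx_coord (R : realType) (m n : nat) (k : 'I_m) (l : 'I_n) :
  measurable_fun setT (fun U : borel_mx R m n => U k l : R).
Proof.
move=> mD; apply: (measurability _ (RGenOpens.measurableE R)) => //.
move=> _ [_ [a [b ->] <-]]; rewrite setTI; apply: sub_sigma_algebra.
have /continuousP := @coord_continuous R m n k l; apply.
exact: interval_open.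
Qed.

(** By [projection_hullP], a countable combination of conditions on the
process alone and of inequalities between measurable functions of
[(e, x)]. *)
Lemma measurable_volume_projection_hull (R : realType) (d i : nat)
    (dO dE : measure_display) (O : measurableType dO) (OE : measurableType dE)
    (eta : R.-ker O ~> borel_mx R 1 d) (E : OE -> 'M[R]_(i, d)) :
  measurable_fun setT (E : OE -> borel_mx R i d) ->
  measurable_fun setT (fun p : O * OE => lebesgue_rV
    (projection (E p.2) (convex_hull (measure_support (eta p.1))))).
Proof.
move=> mE; apply: (measurable_lebesgue_rV (A := fun p : O * OE =>
  projection (E p.2) (convex_hull (measure_support (eta p.1))))).
move=> d' S g f mg mf.
rewrite (eq_set (fun s => propext (projection_hullP (eta (g s).1)
  (E (g s).2) (\row_j f j s)))).
apply: measurable_exists => M; apply: measurable_exists => N.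
apply: measurable_forall => m; apply: measurable_exists => q.
apply: measurable_and; first exact: measurable_constant.
apply: measurable_and3.
- apply: measurable_forall => j; rewrite -[X in measurable X]setTI.
  apply: emeasurable_fun_o_infty => //.
  apply: (measurableT_comp (f := (eta ^~ _))).
    by apply: measurable_kernel; exact: measurable_ball_mx.
  exact: measurableT_comp measurable_fst mg.
- exact: measurable_constant.
apply: measurable_forall => k.
set y := weighted_sum _; set e := _^-1.
pose h s := \sum_l y 0 l * E (g s).2 k l - f k s.
rewrite (_ : [set s | _] = (fun s => `|h s|) @^-1` `]-oo, e]); last first.
  have sE s : (y *m (E (g s).2)^T - \row_j f j s) 0 k = h s.
    by rewrite !mxE; congr (_ - _); apply: eq_bigr => l _; rewrite !mxE.
  by apply/seteqP; split=> s; rewrite /= in_itv /= sE.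
rewrite -[X in measurable X]setTI.
suff mh : measurable_fun setT (fun s => `|h s|).
  by apply: mh => //; exact: measurable_itv.
apply: measurableT_comp => //; apply: measurable_funB => //.
apply: measurable_sum => l; apply: measurable_funM => //.
apply: (measurableT_comp (f := fun U : borel_mx R i d => U k l)).
  exact: measurable_mx_coord.
apply: (measurableT_comp mE).
exact: measurableT_comp measurable_snd mg.
Qed.

(** * Intrinsic volumes and the two models *)

Section intrinsic_volume.
Context (R : realType) (d i : nat) (dE : measure_display).
Context (OE : measurableType dE) (PE : probability OE R).
Context (E : OE -> 'M[R]_(i, d)).
Local Notation V := (intrinsic_volume PE E).
Local Notation mean_shadow K :=
  (\int[PE]_w lebesgue_rV (projection (E w) K))%E.

Lemma mean_shadow_ge0 K : (0 <= mean_shadow K)%E.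
Proof. by apply: integral_ge0 => w _; exact: lebesgue_rV_ge0. Qed.

Lemma intrinsic_volume_constant_ge0 :
  0 <= 'C(d, i)%:R * (fine (lebesgue_rV (@unit_ball R d))
     / (fine (lebesgue_rV (@unit_ball R i))
        * fine (lebesgue_rV (@unit_ball R (d - i))))).
Proof.
by rewrite !(mulr_ge0, invr_ge0)// fine_ge0// lebesgue_rV_ge0.
Qed.

Lemma intrinsic_volume_ge0 K : 0 <= V K.
Proof.
by rewrite mulr_ge0 ?intrinsic_volume_constant_ge0// fine_ge0// mean_shadow_ge0.
Qed.

Lemma intrinsic_volume0 : V set0 = 0.
Proof.
rewrite /intrinsic_volume integral0_eq ?mulr0// => w _.
by rewrite /projection image_set0 lebesgue_rV0.
Qed.

Lemma le_intrinsic_volume A K : A `<=` K -> (mean_shadow K < +oo)%E ->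
  V A <= V K.
Proof.
move=> AK Koo; have AKE : (mean_shadow A <= mean_shadow K)%E.
  apply: ge0_le_integralT => w; first exact: lebesgue_rV_ge0.
  by apply: le_lebesgue_rV; exact: image_subset.
rewrite ler_wpM2l ?intrinsic_volume_constant_ge0//.
by rewrite fine_le// ge0_fin_numE ?mean_shadow_ge0// (le_lt_trans AKE).
Qed.

Hypothesis E_orthonormal : forall w, E w *m (E w)^T = 1%:M.

Lemma orthonormal_coord_le1 w k l : `|E w k l| <= 1.
Proof.
have := congr1 (fun M : 'M[R]_i => M k k) (E_orthonormal w).
rewrite !mxE eqxx mulr1n => s1.
rewrite -(@ler_pXn2r _ 2) ?nnegrE// expr1n real_normK ?num_real//.
rewrite -s1 (bigD1 l)//= mxE -expr2 lerDl sumr_ge0// => j _.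
by rewrite mxE -expr2 sqr_ge0.
Qed.

(** Finiteness matters because [fine] sends an infinite mean to zero, which
would break monotonicity. Rows of unit length keep the shadows in a
common box. *)
Lemma mean_shadow_lty (K : set 'rV[R]_d) : compact K -> (mean_shadow K < +oo)%E.
Proof.
move=> /compact_bounded[M0 [_ KM0]].
pose M : R := `|M0| + 1.
have M0' : 0 <= M by rewrite addr_ge0.
have KM y : K y -> forall l, `|y 0 l| <= M.
  move=> Ky l; apply: le_trans (KM0 M _ y Ky); last first.
    by rewrite ltr_pwDr// ler_norm.
  rewrite [leRHS]/Num.norm /= mx_normrE; apply/bigmax_geP; right.
  by exists (0, l).
pose C := (d%:R * M + d%:R * M) ^+ i.
apply: (@le_lt_trans _ _ (\int[PE]_w (cst C%:E w))%E); last first.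
  rewrite integral_cst// [X in (_ * X)%E](_ : _ = 1%E) ?mule1 ?ltry//.
  exact: (probability_setT PE).
apply: ge0_le_integralT => w; first exact: lebesgue_rV_ge0.
apply: lebesgue_rV_box; first by rewrite mulr_ge0.
move=> _ [y Ky <-] k; rewrite !mxE.
apply: le_trans (ler_norm_sum _ _ _) _.
rewrite mulr_natl -[X in M *+ X]card_ord -sumr_const; apply: ler_sum => l _.
by rewrite mxE normrM -[leRHS]mulr1 ler_pM// ?KM// orthonormal_coord_le1.
Qed.

End intrinsic_volume.

Section null_outside.
Context (R : realType) (d : nat).
Implicit Types (K : set 'rV[R]_d).

Lemma diam_pow_ge0 k (A : set 'rV[R]_d) : (0 <= diam_pow k A)%E.
Proof. by rewrite /diam_pow le_max lexx. Qed.

Lemma hausdorff_premeasure_ge0 k delta (A : set 'rV[R]_d) :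
  (0 <= hausdorff_premeasure k delta A)%E.
Proof.
apply: le_ereal_inf_tmp => _ [C _ <-]; apply: nneseries_ge0 => n _ _.
rewrite mule_ge0 ?diam_pow_ge0// lee_fin divr_ge0 ?exprn_ge0//.
by rewrite fine_ge0// lebesgue_rV_ge0.
Qed.

Lemma hausdorff_measure_ge0 k (A : set 'rV[R]_d) :
  (0 <= hausdorff_measure k A)%E.
Proof.
apply: le_trans (hausdorff_premeasure_ge0 k 1 A) _.
by apply: ereal_sup_ubound; exists 1 => /=.
Qed.

Lemma hausdorff_measure0 k : hausdorff_measure k (set0 : set 'rV[R]_d) = 0%E.
Proof.
apply/eqP; rewrite eq_le hausdorff_measure_ge0 andbT.
apply: ge_ereal_sup => _ [delta _ <-]; apply: ereal_inf_lbound.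
exists (fun=> set0); first by split=> // x.
apply: eseries0 => n _ _.
rewrite /diam_pow (_ : [set _ | _ in _ & _ in _] = set0).
  by rewrite ereal_sup0 max_l ?mule0// leNye.
by rewrite -subset0 => _ [x []].
Qed.

(** In both models [mu] is a multiple of a set function restricted to a
subset of [K], and that set function vanishes on the empty set. *)
Lemma model_null_outside K (mu : probability (borel_mx R 1 d) R) :
  closed K -> model_In K mu \/ model_Bd K mu -> mu (~` K) = 0%E.
Proof.
move=> cK; have mK : measurable (~` K : set (borel_mx R 1 d)).
  by apply: sub_sigma_algebra; exact: closed_openC.
move=> [/(_ _ mK)->|[_ /(_ _ mK)->]].
  by rewrite setICl lebesgue_rV0 mule0.
rewrite (_ : ~` K `&` _ = set0) ?hausdorff_measure0 ?mule0// -subset0.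
by move=> x [nKx [+ _]]; rewrite -((closure_id K).1 cK).
Qed.

End null_outside.

(** * Concentration of the hull of the Poisson process *)

Section constants.
Context (R : realType).

Lemma sqrt_expR1_gt1 : 1 < Num.sqrt (expR 1) :> R.
Proof. by rewrite -[ltLHS]sqrtr1 ltr_sqrt ?expR_gt0// expR_gt1. Qed.

Lemma kappa_ge_half : 2^-1 <= kappa R.
Proof.
have s1 := sqrt_expR1_gt1; rewrite /kappa; set s := Num.sqrt _ in s1 *.
have ds : 0 < 2 * (s - 1) by rewrite mulr_gt0// subr_gt0.
by rewrite ler_pdivlMr// mulKf// gerBl.
Qed.

Lemma tail_constant_bounds : 0 <= ln 2 / (8 * kappa R) <= 2^-1.
Proof.
have k1 := kappa_ge_half.
have k0 : 0 < 8 * kappa R by rewrite mulr_gt0// (lt_le_trans _ k1).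
have l0 : 0 <= ln 2 :> R by rewrite ln_ge0// ler1n.
have l1 : ln 2 <= 1 :> R.
  rewrite -ler_expR lnK ?posrE// -[leLHS]/(1 + 1); exact: expR_ge1Dx.
rewrite divr_ge0 ?(ltW k0)//= ler_pdivrMr//; lra.
Qed.

End constants.

Lemma poisson_prob0 (R : realType) (a : R) : 0 <= a ->
  poisson_prob a 0 [set 0%N] = (expR (- a))%:E.
Proof.
rewrite le_eqVlt /poisson_prob => /predU1P[<-|a0].
  by rewrite ltxx oppr0 expR0 diracE mem_set.
by rewrite a0 esum_set1 /poisson_pmf a0 fact0 expr0 invr1 !mul1r.
Qed.

Section random_hull.
Context (R : realType) (d i : nat) (K : set 'rV[R]_d).
Context (gamma : R) (mu : probability (borel_mx R 1 d) R).
Context (dO : measure_display) (O : measurableType dO) (P : probability O R).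
Context (eta : R.-ker O ~> borel_mx R 1 d).
Context (dE : measure_display) (OE : measurableType dE) (PE : probability OE R).
Context (E : OE -> 'M[R]_(i, d)).
Hypotheses (gamma_gt0 : 0 < gamma) (K_body : convex_body K).
Hypothesis mu_model : model_In K mu \/ model_Bd K mu.
Hypothesis eta_poisson : poisson_process P eta (fun B => (gamma%:E * mu B)%E).
Hypothesis E_uniform : uniform_subspace PE E.

Local Notation V := (intrinsic_volume PE E).
Local Notation F := (fun w => V (convex_hull (measure_support (eta w)))).

Let compactK : compact K. Proof. by case: K_body. Qed.
Let convexK : convex_set K. Proof. by case: K_body. Qed.
Let closedK : closed K.
Proof. by apply: compact_closed compactK; exact: norm_hausdorff. Qed.

(** Tonelli's theorem, for the mean over the random subspace. *)
Lemma measurable_hull_volume : measurable_fun setT F.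
Proof.
have [mE _ _] := E_uniform.
apply: measurable_funM; first exact: measurable_cst.
apply: (measurableT_comp (fine_measurable measurableT)).
pose f (p : O * OE) := lebesgue_rV
  (projection (E p.2) (convex_hull (measure_support (eta p.1)))).
apply: (@measurable_fun_fubini_tonelli_F _ _ O OE R PE f).
  exact: measurable_volume_projection_hull.
by move=> p; exact: lebesgue_rV_ge0.
Qed.

Definition nonempty_process : set O := [set w | eta w setT != 0%E].

Lemma measurable_eta_eq0 (B : set (borel_mx R 1 d)) : measurable B ->
  measurable [set w | eta w B = 0%E].
Proof.
move=> mB; have := measurable_kernel eta B mB measurableT [set 0%E].
by rewrite setTI; apply; exact: emeasurable_set1.
Qed.

Lemma measurable_nonempty_process : measurable nonempty_process.
Proof. exact: kernel_measurable_neq_cst. Qed.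

Lemma prob_eta_eq0 (B : set (borel_mx R 1 d)) : measurable B ->
  P [set w | eta w B = 0%E] = (expR (- fine (gamma%:E * mu B)))%:E.
Proof.
move=> mB; have [_ + _] := eta_poisson => /(_ B 0%N mB) ->.
by rewrite poisson_prob0// fine_ge0// mule_ge0// lee_fin ltW.
Qed.

(** The probability is [1 - exp (- gamma)], and [1 - gamma <= exp (- gamma)]. *)
Lemma prob_nonempty_le : (P nonempty_process <= gamma%:E)%E.
Proof.
rewrite (_ : nonempty_process = ~` [set w | eta w setT = 0%E]); last first.
  by apply/seteqP; split=> w /eqP.
rewrite probability_setC; last exact: measurable_eta_eq0.
rewrite prob_eta_eq0// probability_setT mule1 -EFinB lee_fin.
by rewrite lerBlDr -lerBlDl expR_ge1Dx.
Qed.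

(** The exceptional null set is the event that the process charges the
complement of [K]. Off it, every point of the support is in [K], since
the complement of [K] is open. *)
Lemma hull_volume_le :
  {ae P, forall w, F w <= V K * \1_nonempty_process w}.
Proof.
have mK : measurable (~` K : set (borel_mx R 1 d)).
  by apply: sub_sigma_algebra; exact: closed_openC.
exists (~` [set w | eta w (~` K) = 0%E]); split.
- exact/measurableC/measurable_eta_eq0.
- rewrite probability_setC; last exact: measurable_eta_eq0.
  by rewrite prob_eta_eq0// model_null_outside// mule0 oppr0 expR0 subee.
move=> w /=; apply: contra_not => etaK.
rewrite indicE; have [ne|e] := boolP (w \in _).
  rewrite mulr1; apply: le_intrinsic_volume; last first.
    by apply: mean_shadow_lty => //; case: E_uniform.
  apply: convex_hull_sub => // x Sx; apply: contrapT => Kx.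
  by have := Sx (~` K) (closed_openC closedK) Kx; rewrite etaK ltxx.
rewrite mulr0 (_ : measure_support _ = set0) ?convex_hull0 ?intrinsic_volume0//.
rewrite -subset0 => x /(_ setT openT Logic.I).
by move: e; rewrite notin_setE => /negP; rewrite negbK => /eqP ->; rewrite ltxx.
Qed.

End random_hull.

Theorem proposition5p2 (R : realType) (d i : nat) (i_range : (0 < i < d)%N)
  (K : set 'rV[R]_d) (K_body : convex_body K)
  (K_vol : (0 < lebesgue_rV K < +oo)%E)
  (gamma : R) (gamma_gt0 : 0 < gamma)
  (mu : probability (borel_mx R 1 d) R)
  (mu_model : model_In K mu \/ model_Bd K mu)
  (dO : measure_display) (O : measurableType dO) (P : probability O R)
  (eta : R.-ker O ~> borel_mx R 1 d)
  (eta_poisson : poisson_process P eta (fun B => (gamma%:E * mu B)%E))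
  (dE : measure_display) (OE : measurableType dE) (PE : probability OE R)
  (E : OE -> 'M[R]_(i, d)) (E_uniform : uniform_subspace PE E) :
  let V := intrinsic_volume PE E in
  let F := fun w => V (convex_hull (measure_support (eta w))) in
  let c := ln 2 / (8 * kappa R) in
  forall t : R, 4 * Num.sqrt (kappa R) <= t ->
    (P [set w | ('E_P[F] + t%:E <= (F w)%:E)%E]
       <= (expR (- (c * t ^+ 2 / (i.+1%:R * V K ^+ 2))))%:E)%E /\
    (P [set w | ((F w)%:E <= 'E_P[F] - t%:E)%E]
       <= (expR (- (c * t ^+ 2 / (gamma * V K ^+ 2))))%:E)%E.
Proof.
move=> V F c t tk.
have t0 : 0 < t.
  apply: lt_le_trans tk; rewrite mulr_gt0// sqrtr_gt0.
  by apply: lt_le_trans (kappa_ge_half R).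
have /andP[c0 c12] := tail_constant_bounds R; rewrite -/c in c0 c12.
have mF : measurable_fun setT F by exact: measurable_hull_volume E_uniform.
have mA := measurable_nonempty_process eta.
have F0 w : 0 <= F w by exact: intrinsic_volume_ge0.
have V0 : 0 <= V K by exact: intrinsic_volume_ge0.
have FV := hull_volume_le gamma_gt0 K_body mu_model eta_poisson E_uniform.
split; last first.
  apply: lower_tail mF mA F0 V0 FV _ _ _ c12 t0 _.
  exact: prob_nonempty_le eta_poisson.
rewrite (_ : c * t ^+ 2 / _ = c / i.+1%:R * t ^+ 2 / V K ^+ 2); last first.
  by rewrite invfM mulrA; congr (_ * _); rewrite mulrAC.
apply: upper_tail mF mA F0 V0 FV _ _ _ t0.
by apply: le_trans c12; rewrite ler_pdivrMr// ler_peMr// ler1n.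
Qed.
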